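(* Let $G_1$ and $G_2$ be finite graphs. If $G_1$ and $G_2$ are distinguished by the Weisfeiler--Leman (WL) test, then there exists a tree $T$ such that the number of homomorphisms from $T$ to $G_1$ is different from the number of homomorphisms from $T$ to $G_2$.
   Context: Graphs are finite, simple and undirected. A tree is a finite connected acyclic graph with at least one node (the single-node graph is a tree). WL-labels: for each integer $k\ge 0$ and each node $u$ of a graph, the $k$-level WL-label $\ell_k(u)$ is defined inductively. For $k=0$, all nodes of all graphs have the same $0$-level WL-label. The $(k+1)$-level WL-label $\ell_{k+1}(u)$ of a node $u$ is the multiset of the $k$-level WL-labels of the neighbors of $u$. WL test: two graphs $G_1$ and $G_2$ are distinguished by the WL test if for some $k\ge 0$ the multiset of the $k$-level WL-labels of all nodes of $G_1$ differs from the multiset of the $k$-level WL-labels of all nodes of $G_2$. Homomorphism: a homomorphism from a graph $H$ to a graph $G$ is a mapping from the set of nodes of $H$ to the set of nodes of $G$ that sends adjacent nodes of $H$ to adjacent nodes of $G$. *)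

(* Defs.v *)
From mathcomp Require Import all_boot.
From mathcomp Require Import finmap multiset.

Set Implicit Arguments.
Unset Strict Implicit.
Unset Printing Implicit Defensive.

Record sgraph := SGraph {
  vertex :> finType;
  adj : rel vertex;
  adj_sym : symmetric adj;
  adj_irrefl : irreflexive adj
}.

Definition connected (G : sgraph) : Prop :=
  forall x y : G, connect (@adj G) x y.

(* [cycle] accepts c = [:: x; y] as soon as x and y are adjacent (the edge
   walked back and forth); a graph cycle has at least three nodes. *)
Definition acyclic (G : sgraph) : Prop :=
  forall c : seq G, 2 < size c -> uniq c -> ~~ cycle (@adj G) c.

Definition is_tree (G : sgraph) : Prop :=
  [/\ 0 < #|G|, connected G & acyclic G].

(* Labels are the iterated multisets themselves and their type depends only on
   the level, so labels of nodes of different graphs can be compared with [=]. *)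
Fixpoint wl_label_type (k : nat) : choiceType :=
  if k is k'.+1 then multiset (wl_label_type k') else unit.

Fixpoint wl_label (G : sgraph) (k : nat) : G -> wl_label_type k :=
  if k is k'.+1 return G -> wl_label_type k
  then fun u => seq_mset [seq wl_label k' v | v <- enum (adj u)]
  else fun=> tt.

Definition wl_graph_label (G : sgraph) (k : nat) : multiset (wl_label_type k) :=
  seq_mset [seq wl_label k u | u <- enum G].

Definition wl_distinguished (G1 G2 : sgraph) : Prop :=
  exists k : nat, wl_graph_label G1 k <> wl_graph_label G2 k.

Definition is_hom (H G : sgraph) (f : {ffun H -> G}) : bool :=
  [forall x, forall y, adj x y ==> adj (f x) (f y)].

Definition nb_hom (H G : sgraph) : nat :=
  #|[set f : {ffun H -> G} | is_hom f]|.

(* Main.v *)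
From mathcomp Require Import all_boot all_algebra.
From mathcomp Require Import finmap multiset.
Require Import Defs.

Set Implicit Arguments.
Unset Strict Implicit.
Unset Printing Implicit Defensive.

Import GRing.Theory.

(** Root a tree [T] and let [T(p)] be the number of homomorphisms from [T] to
    a graph that send the root of [T] to the node [p].  The number of
    homomorphisms from [T] to [G] is the sum of [T(p)] over the nodes [p] of
    [G], so it suffices to show that sums of this kind, over the rooted trees
    of height at most [k], determine the multiset of the [k]-level WL-labels of
    the nodes over which they are taken ([label_multiset_detected]).

    Hanging trees [t1, ..., tn] below a new root gives a tree whose value at
    [p] is the product over [i] of the sums of [ti(q)] over the neighbors [q]
    of [p] ([rhom_branches]).  Three properties follow, for each [k]:
    - the functions [p |-> T(p)], for [T] of height at most [k], contain the
      constant 1 and are closed under products, since two trees can be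
      identified at their roots ([rhom_leaf], [rhom_glue]);
    - they depend only on the [k]-level label of [p] ([rhom_root_label]);
    - they separate any two distinct [k]-level labels ([rhom_separates]).

    A family of functions with these properties spans, on finitely many nodes,
    all rational-valued functions of the label, by interpolation: multiply, over
    the other labels [l'], the functions [f - f(l')] with [f] separating [l']
    from the chosen label.  Thus its sums over a multiset of nodes determine the
    number of occurrences of each label.  This is used twice: on the nodes of
    the two graphs, for the theorem, and on the neighbors of two nodes, for the
    step from [k] to
    [k + 1] in the third property.  The two labels of level [k + 1] are then
    different multisets of [k]-level labels, so some tree [t] of height at most
    [k] has different sums over the two neighborhoods, and these sums are the
    values of the tree with the single branch [t]. *)

(** * Families of functions that separate labels *)

Section Separation.
Local Open Scope ring_scope.

Variables (X T : Type) (K : eqType) (L : X -> K) (f : T -> X -> nat).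
Variables (one : T) (mul : T -> T -> T).
Hypothesis f_one : forall x, f one x = 1%N.
Hypothesis f_mul : forall s t x, f (mul s t) x = (f s x * f t x)%N.
Hypothesis f_class : forall t x y, L x = L y -> f t x = f t y.
Hypothesis f_sep : forall x y, L x <> L y -> exists t, f t x <> f t y.

(** Interpolation with integer weights, one label at a time: if [f t] separates
    [x0] from [y], multiplying each weight by [f t - f t y] kills the class of
    [y] and scales the weight of the class of [x0] by a nonzero factor.  The new
    sum against [f u] is the old sum against [f t * f u] minus [f t y] times the
    old sum against [f u], so one of these two is nonzero. *)
Lemma class_weight_detected (ws : seq (int * X)) (x0 : X) :
  \sum_(p <- ws | L p.2 == L x0) p.1 != 0 ->
  exists t, \sum_(p <- ws) p.1 * (f t p.2)%:Z != 0.
Proof.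
(* Outside the class of x0, only the classes of the points of s carry weight;
   the induction kills them in turn. *)
have [s cov] : exists s : seq X, all (fun p : int * X =>
    [|| p.1 == 0, L p.2 == L x0 | L p.2 \in map L s]) ws.
  exists (map snd ws); elim: ws => //= p ws IH.
  rewrite in_cons eqxx !orbT /=; apply: sub_all IH => q.
  by rewrite in_cons; case/or3P=> ->; rewrite ?orbT.
elim: s ws cov => [|y s IH] ws cov nz.
  (* All the weight lies on the class of x0: the constant 1 detects it. *)
  exists one; move: nz; congr (_ != 0); rewrite big_mkcond.
  elim: ws cov => [|p ws IHw] /=; first by rewrite !big_nil.
  rewrite !big_cons f_one mulr1 in_nil orbF => /andP[+ /IHw->].
  by case: (L p.2 == L x0); rewrite ?orbF // => /eqP->.
have [Lxy|/eqP/f_sep[t ft]] := eqVneq (L x0) (L y).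
  apply: IH nz; apply: sub_all cov => p /=.
  by rewrite in_cons -Lxy; do 2!case: eqP.
pose ws' := [seq (p.1 * ((f t p.2)%:Z - (f t y)%:Z), p.2) | p <- ws].
have [|| u] := IH ws'.
- rewrite all_map; apply: sub_all cov => p /=; rewrite in_cons.
  case/or4P=> [/eqP->|->|/eqP Ly|->]; rewrite ?mul0r ?eqxx ?orbT //.
  by rewrite (f_class t Ly) subrr mulr0 eqxx.
- rewrite big_map /=.
  rewrite (eq_bigr (fun p => p.1 * ((f t x0)%:Z - (f t y)%:Z))); last first.
    by move=> p /eqP Lp; rewrite (f_class t Lp).
  by rewrite -mulr_suml mulf_neq0 // subr_eq0; apply/eqP=> -[].
rewrite big_map /=.
rewrite (eq_bigr (fun p => p.1 * (f (mul t u) p.2)%:Z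
    - (f t y)%:Z * (p.1 * (f u p.2)%:Z))); last first.
  by move=> p _; rewrite f_mul PoszM mulrBr mulrBl mulrA mulrCA !mulrA.
rewrite sumrB -mulr_sumr.
have [->|] := eqVneq (\sum_(p <- ws) p.1 * (f u p.2)%:Z) 0; last by exists u.
by rewrite mulr0 subr0; exists (mul t u).
Qed.

Lemma label_multiset_detected (s1 s2 : seq X) :
  ~~ perm_eq (map L s1) (map L s2) ->
  exists t, (\sum_(x <- s1) f t x)%N <> (\sum_(x <- s2) f t x)%N.
Proof.
move=> neq; pose ws : seq (int * X) := map (pair 1) s1 ++ map (pair (-1)) s2.
have [x0 nx0] : exists x0,
    count_mem (L x0) (map L s1) != count_mem (L x0) (map L s2).
  move: neq; rewrite /perm_eq -map_cat all_map.
  elim: (s1 ++ s2) => //= x s IH; rewrite negb_and => /orP[nx|/IH//].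
  by exists x.
have [|t ht] := @class_weight_detected ws x0.
  rewrite big_cat !big_map /= sumrN subr_eq0.
  rewrite !big_const_seq !iter_addr_0 !natz.
  by move: nx0; rewrite !count_map; apply: contraNN => /eqP[->].
exists t => e; case/eqP: ht; rewrite big_cat !big_map /=.
under eq_bigr do rewrite mul1r.
under [X in _ + X]eq_bigr do rewrite mulN1r.
by rewrite sumrN -!(big_morph Posz PoszD erefl) e subrr.
Qed.

End Separation.

(** * Rooted graphs and rooted homomorphisms *)

Record pgraph := PGraph { pg_graph :> sgraph; pg_root : pg_graph }.

Definition rhom (T p : pgraph) : nat :=
  #|[set f : {ffun T -> p} | is_hom f && (f (pg_root T) == pg_root p)]|.

(** The neighbors are kept as rooted graphs, so that neighbors taken in
    different graphs have the same type. *)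
Definition nbrs (p : pgraph) : seq pgraph :=
  [seq PGraph v | v <- enum (adj (pg_root p))].

Lemma nb_hom_root (T : pgraph) (G : sgraph) :
  nb_hom T G = \sum_(v : G) rhom T (PGraph v).
Proof.
rewrite /nb_hom -sum1dep_card.
rewrite (partition_big (fun f : {ffun T -> G} => f (pg_root T)) predT) //=.
by apply: eq_bigr => v _; rewrite sum1dep_card.
Qed.

Definition point_adj : rel unit := fun _ _ => false.

Lemma point_adj_sym : symmetric point_adj. Proof. by []. Qed.
Lemma point_adj_irrefl : irreflexive point_adj. Proof. by []. Qed.

Definition point : pgraph := @PGraph (SGraph point_adj_sym point_adj_irrefl) tt.

Lemma point_tree : is_tree point.
Proof.
split; first by rewrite card_unit.
  by case=> -[]; apply: connect0.
by move=> [|[] [|[] c]] //=.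
Qed.

Lemma rhom_point (p : pgraph) : rhom point p = 1.
Proof.
rewrite /rhom -(cards1 [ffun _ : point => pg_root p]); congr #|pred_of_set _|.
apply/setP=> f; rewrite !inE; apply/andP/eqP => [[_ /eqP fr]|->].
  by apply/ffunP => -[]; rewrite ffunE.
by split; [apply/'forall_forallP | rewrite ffunE].
Qed.

(** * Grafting a rooted tree below the root of another *)

Lemma acyclic_image (H G : sgraph) (i : H -> G) (c : seq G) :
  injective i -> (forall x y, adj (i x) (i y) = adj x y) -> acyclic H ->
  {subset c <= codom i} -> 2 < size c -> uniq c -> ~~ cycle (@adj G) c.
Proof.
move=> inj_i adj_i acH /map_preim <-.
rewrite size_map map_inj_uniq // cycle_map => sz uc.
by rewrite (eq_cycle (e' := @adj H)) ?acH // => x y; apply: adj_i.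
Qed.

Section Graft.
Variables A B : pgraph.

(** [A] and [B] side by side, with one extra edge between their roots: [B]
    becomes a new branch at the root of [A]. *)
Definition graft_adj : rel (A + B) := fun x y =>
  match x, y with
  | inl a, inl a' => adj a a'
  | inr b, inr b' => adj b b'
  | inl a, inr b | inr b, inl a => (a == pg_root A) && (b == pg_root B)
  end.

Lemma graft_adj_sym : symmetric graft_adj.
Proof. by case=> x [] y //=; apply: adj_sym. Qed.

Lemma graft_adj_irrefl : irreflexive graft_adj.
Proof. by case=> x /=; apply: adj_irrefl. Qed.

Definition graft : pgraph :=
  @PGraph (SGraph graft_adj_sym graft_adj_irrefl) (inl (pg_root A)).

Lemma graft_connected : connected A -> connected B -> connected graft.
Proof.
move=> cA cB.
have reach (z : graft) : connect (@adj graft) (pg_root graft) z.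
  have homo (H : sgraph) (i : H -> graft) (x y : H) :
      {homo i : u v / adj u v >-> adj u v} ->
      connect (@adj H) x y -> connect (@adj graft) (i x) (i y).
    move=> hi /connectP[p xp ->]; apply/connectP; exists (map i p).
      exact: homo_path xp.
    by rewrite last_map.
  case: z => z; first exact: (homo A inl).
  apply: (@connect_trans _ _ (inr (pg_root B))).
    by apply: connect1; rewrite /= !eqxx.
  exact: (homo B inr).
move=> x y; apply: connect_trans (reach y).
by rewrite (sym_connect_sym (@adj_sym graft)).
Qed.

(** The only edge between the two sides ends at the root of [B]. *)
Lemma graft_path_side (x : graft) (p : seq graft) :
  path (@adj graft) x p -> inr (pg_root B) \notin x :: p ->
  all (fun y : graft => is_inl y == is_inl x) p.
Proof.
elim: p x => //= y p IH x /andP[xy yp].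
rewrite inE negb_or => /andP[xb yb].
have side : is_inl y == is_inl x.
  move: xb yb xy; rewrite inE negb_or => /[swap] /andP[yb _].
  by case: x y yb {IH yp} => x [] y //= + + /andP[_ /eqP E]; rewrite E eqxx.
by rewrite side -(eqP side); apply: IH.
Qed.

(** A cycle of the graft that avoids the root of [B] stays on one side.  A cycle
    through that root leaves it for a node that is either in [B], and then the
    whole cycle is in [B], or the root of [A]; in the latter case the cycle
    stays in [A] until it comes back to the root of [B], which it can do only
    from the root of [A], visited a second time. *)
Lemma graft_acyclic : acyclic A -> acyclic B -> acyclic graft.
Proof.
move=> acA acB.
have onA c : 2 < size c -> uniq c ->
    all (fun y : graft => is_inl y == true) c -> ~~ cycle (@adj graft) c.
  move=> sz uc /allP side; apply: (@acyclic_image A graft inl) sz uc => //.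
    by move=> ? ? [].
  by case=> x /side // _; apply: codom_f.
have onB c : 2 < size c -> uniq c ->
    all (fun y : graft => is_inl y == false) c -> ~~ cycle (@adj graft) c.
  move=> sz uc /allP side; apply: (@acyclic_image B graft inr) sz uc => //.
    by move=> ? ? [].
  by case=> x /side // _; apply: codom_f.
move=> c sz uc; apply/negP => cyc.
have [bc|bc] := boolP (inr (pg_root B) \in c); last first.
  case: c sz uc cyc bc => // x c sz uc cyc bc.
  have xc : path (@adj graft) x c.
    by move: cyc; rewrite /= rcons_path => /andP[].
  have sd := graft_path_side xc bc.
  case: x sz uc cyc xc bc sd => x sz uc cyc xc bc sd.
    by case/negP: (onA _ sz uc sd).
  by case/negP: (onB _ sz uc sd).
(* Start the cycle at the root of B, followed by y. *)
case: (rot_to bc) => i d cE.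
move: sz uc cyc; rewrite -(size_rot i) -(rot_uniq i) -(rot_cycle i) cE.
case: d {cE} => [|y d] // sz ub cyc.
have yd : path (@adj graft) y d.
  by move: cyc; rewrite /= rcons_path => /and3P[].
have bd : inr (pg_root B) \notin y :: d by case/andP: ub.
have sd := graft_path_side yd bd.
case: y sz ub cyc yd bd sd => y sz ub cyc yd bd sd; last first.
  by case/negP: (onB _ sz ub sd).
(* Here y is the root of A; the last node z of the cycle is in A and adjacent
   to the root of B, hence equal to y. *)
have ya : y = pg_root A by move: cyc; rewrite /= => /andP[/andP[/eqP]].
case/lastP: d sz ub cyc yd bd sd => // d z _ /and3P[_ + _] + _ _.
rewrite mem_rcons inE negb_or all_rcons => /andP[yz _].
rewrite /= !rcons_path last_rcons => /and3P[_ _ zb] /andP[zl _].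
by case: z zl zb yz => //= z _ /andP[/eqP-> _]; rewrite ya eqxx.
Qed.

Lemma graft_tree : is_tree A -> is_tree B -> is_tree graft.
Proof.
move=> [nA cA aA] [nB cB aB]; split.
- by apply/card_gt0P; exists (pg_root graft).
- exact: graft_connected.
- exact: graft_acyclic.
Qed.

Lemma is_hom_graft (G : sgraph) (f : {ffun graft -> G}) :
  is_hom f = [&& is_hom [ffun a : A => f (inl a)],
                 is_hom [ffun b : B => f (inr b)]
               & adj (f (inl (pg_root A))) (f (inr (pg_root B)))].
Proof.
apply/'forall_forallP/and3P => [hf|[/'forall_forallP hA /'forall_forallP hB hr]].
  split.
  - by apply/'forall_forallP => a a'; rewrite !ffunE; apply: hf (inl a) (inl a').
  - by apply/'forall_forallP => b b'; rewrite !ffunE; apply: hf (inr b) (inr b').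
  - by apply: (implyP (hf (inl _) (inr _))); rewrite /= !eqxx.
case=> x [] y.
- by have := hA x y; rewrite !ffunE.
- by apply/implyP => /andP[/eqP-> /eqP->].
- by apply/implyP => /andP[/eqP-> /eqP->]; rewrite adj_sym.
- by have := hB x y; rewrite !ffunE.
Qed.

(** A homomorphism on the graft with the root sent to [r] amounts to one on [A]
    sending its root to [r] and, independently, one on [B] sending its root to
    some neighbor of [r]. *)
Lemma rhom_graft (p : pgraph) :
  rhom graft p = rhom A p * \sum_(q <- nbrs p) rhom B q.
Proof.
pose HB := [set g : {ffun B -> p} |
              is_hom g && adj (pg_root p) (g (pg_root B))].
have -> : \sum_(q <- nbrs p) rhom B q = #|HB|.
  rewrite big_map big_enum /= -sum1dep_card.
  rewrite (partition_big (fun g : {ffun B -> p} => g (pg_root B))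
             (adj (pg_root p))) /=; last by move=> g /andP[].
  apply: eq_bigr => v pv; rewrite /rhom -sum1dep_card; apply: eq_bigl => g.
  by case: eqP => [->|]; rewrite ?andbF ?andbT //= [_ v]pv andbT.
rewrite -cardsX.
pose r (f : {ffun graft -> p}) :=
  ([ffun a : A => f (inl a)], [ffun b : B => f (inr b)]).
pose r' (gh : {ffun A -> p} * {ffun B -> p}) : {ffun graft -> p} :=
  [ffun x : graft => match x with inl a => gh.1 a | inr b => gh.2 b end].
have bij : bijective r.
  exists r' => [f|[g h]]; first by apply/ffunP=> -[] x; rewrite !ffunE.
  by congr pair; apply/ffunP => x; rewrite !ffunE.
rewrite -(on_card_preimset (onW_bij _ bij)).
apply: eq_card => f; rewrite !inE is_hom_graft /= !ffunE.
by case: (f (inl _) =P pg_root p) => [->|]; rewrite ?andbF ?andbT //= andbA.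
Qed.

End Graft.

(** * Rooted trees of bounded height *)

(** A rooted tree of height at most [k], given by the list of its branches.  The
    recursion on [k] is that of [wl_label_type], with lists for multisets. *)
Fixpoint rtree (k : nat) : Type := if k is k'.+1 then seq (rtree k') else unit.

Fixpoint graph_of (k : nat) : rtree k -> pgraph :=
  if k is k'.+1 return rtree k -> pgraph
  then foldr (fun t A => graft A (graph_of t)) point
  else fun=> point.

Lemma graph_of_tree (k : nat) (t : rtree k) : is_tree (graph_of t).
Proof.
elim: k t => [t|k IH]; first exact: point_tree.
by elim=> [|t ts IHts]; [exact: point_tree | apply: graft_tree].
Qed.

Lemma rhom_branches (k : nat) (ts : rtree k.+1) (p : pgraph) :
  rhom (graph_of ts) p =
  \prod_(t <- ts) \sum_(q <- nbrs p) rhom (graph_of t) q.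
Proof.
elim: ts => [|t ts IH]; first by rewrite big_nil rhom_point.
by rewrite big_cons /= rhom_graft IH mulnC.
Qed.

Definition leaf (k : nat) : rtree k :=
  if k is k'.+1 return rtree k then [::] else tt.

Definition glue (k : nat) : rtree k -> rtree k -> rtree k :=
  if k is k'.+1 return rtree k -> rtree k -> rtree k then cat else fun _ _ => tt.

Lemma rhom_leaf (k : nat) (p : pgraph) : rhom (graph_of (leaf k)) p = 1.
Proof. by case: k => [|k]; apply: rhom_point. Qed.

Lemma rhom_glue (k : nat) (s t : rtree k) (p : pgraph) :
  rhom (graph_of (glue s t)) p = rhom (graph_of s) p * rhom (graph_of t) p.
Proof.
case: k s t => [|k] s t; first by rewrite /= rhom_point.
by rewrite !rhom_branches big_cat.
Qed.

(** * Rooted homomorphism counts and WL-labels *)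

Definition root_label (k : nat) (p : pgraph) : wl_label_type k :=
  wl_label k (pg_root p).

Lemma root_labelS (k : nat) (p q : pgraph) :
  root_label k.+1 p = root_label k.+1 q <->
  perm_eq (map (root_label k) (nbrs p)) (map (root_label k) (nbrs q)).
Proof.
by rewrite -!map_comp; split=> /eq_seq_msetP.
Qed.

(** [f] factors through [L] on the finitely many points involved. *)
Lemma eq_sum_class (X : Type) (K : eqType) (L : X -> K) (f : X -> nat)
    (s1 s2 : seq X) :
  (forall x y, L x = L y -> f x = f y) -> perm_eq (map L s1) (map L s2) ->
  \sum_(x <- s1) f x = \sum_(x <- s2) f x.
Proof.
move=> fL perm12.
have [g gP] : exists g, all (fun x => g (L x) == f x) (s1 ++ s2).
  elim: (s1 ++ s2) => [|x s [g IH]]; first by exists (fun=> 0).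
  exists (fun l => if l == L x then f x else g l); rewrite /= !eqxx /=.
  by apply: sub_all IH => y; case: (L y =P L x) => // /fL->.
have sumE s : all (fun x => g (L x) == f x) s ->
    \sum_(x <- s) f x = \sum_(l <- map L s) g l.
  elim: s => [|x s IH] /=; first by rewrite !big_nil.
  by rewrite !big_cons => /andP[/eqP-> /IH->].
move: gP; rewrite all_cat => /andP[g1 g2].
by rewrite !sumE //; apply: perm_big.
Qed.

Lemma rhom_root_label (k : nat) (t : rtree k) (p q : pgraph) :
  root_label k p = root_label k q -> rhom (graph_of t) p = rhom (graph_of t) q.
Proof.
elim: k t p q => [|k IH] ts p q; first by rewrite !rhom_point.
move=> /root_labelS perm_pq; rewrite !rhom_branches; apply: eq_bigr => t _.
by apply: eq_sum_class perm_pq; apply: IH.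
Qed.

(** In the induction step, the separation of [k]-level labels is the hypothesis
    under which [label_multiset_detected] applies to the two neighborhoods. *)
Lemma rhom_separates (k : nat) (p q : pgraph) :
  root_label k p <> root_label k q ->
  exists t : rtree k, rhom (graph_of t) p <> rhom (graph_of t) q.
Proof.
elim: k p q => [|k IH] p q.
  by case: (root_label _ _) (root_label _ _) => -[].
move=> /root_labelS/negP npq.
have [t nt] := label_multiset_detected
  (f := fun t : rtree k => rhom (graph_of t)) (@rhom_leaf k) (@rhom_glue k)
  (@rhom_root_label k) IH npq.
by exists [:: t]; rewrite !rhom_branches !big_seq1.
Qed.

Theorem theorem1 (G1 G2 : sgraph) (hWL : wl_distinguished G1 G2) :
  exists T : sgraph, is_tree T /\ nb_hom T G1 <> nb_hom T G2.
Proof.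
case: hWL => k /eq_seq_msetP nG.
pose nodes (G : sgraph) : seq pgraph := [seq PGraph v | v <- enum G].
have [|t nt] := label_multiset_detected
  (f := fun t : rtree k => rhom (graph_of t)) (@rhom_leaf k) (@rhom_glue k)
  (@rhom_root_label k) (@rhom_separates k) (s1 := nodes G1) (s2 := nodes G2).
  by rewrite -![map (root_label k) _]map_comp.
exists (graph_of t); split; first exact: graph_of_tree.
by rewrite !nb_hom_root; move: nt; rewrite big_map big_enum big_map big_enum.
Qed.
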